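(* Let $m\ge 2$, and let $G$ be a graph on $n$ vertices which is the underlying graph of an $m$-uniform linear hypergraph with $e$ hyperedges in which every vertex lies in at least one hyperedge. Assume $n-e>0$. Then the largest eigenvalue $\lambda_{n-1}$ of the normalized Laplacian matrix $\mathbf L(G)=\mathbf I-\mathbf D^{-1/2}\mathbf A\mathbf D^{-1/2}$ satisfies \[\lambda_{n-1}=\frac{m}{m-1}.\]
   Context: $\mathbf A$ is the adjacency matrix of $G$ and $\mathbf D$ is the diagonal matrix of vertex degrees. A hypergraph (finite, on a vertex set $V$, with distinct hyperedges that are subsets of $V$) is $m$-uniform if every hyperedge has exactly $m$ vertices, and linear if any two distinct hyperedges intersect in at most one vertex. Its underlying graph has the same vertex set, with two distinct vertices adjacent if and only if some hyperedge contains both; i.e. each hyperedge is replaced by a clique on $m$ vertices. *)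

(* Defs.v *)
From mathcomp Require Import all_boot all_order all_algebra.

Set Implicit Arguments.
Unset Strict Implicit.
Unset Printing Implicit Defensive.

Import Order.TTheory GRing.Theory Num.Theory.
Local Open Scope ring_scope.

Definition simple_graph (V : finType) (g : rel V) : Prop :=
  symmetric g /\ irreflexive g.

(* A hypergraph on V is its set of hyperedges H : {set {set V}}, so hyperedges
   are automatically distinct. *)
Definition uniform (V : finType) (m : nat) (H : {set {set V}}) : Prop :=
  forall h, h \in H -> #|h| = m.

Definition linear_hypergraph (V : finType) (H : {set {set V}}) : Prop :=
  forall h1 h2, h1 \in H -> h2 \in H -> h1 != h2 -> (#|h1 :&: h2| <= 1)%N.

Definition no_isolated_vertex (V : finType) (H : {set {set V}}) : Prop :=
  forall v : V, exists2 h, h \in H & v \in h.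

Definition underlying_graph (V : finType) (H : {set {set V}}) : rel V :=
  [rel u v | (u != v) && [exists h in H, (u \in h) && (v \in h)]].

Definition degree (V : finType) (g : rel V) (v : V) : nat := #|[set w | g v w]|.

Definition adjacency_mx (R : rcfType) (n : nat) (g : rel 'I_n) : 'M[R]_n :=
  \matrix_(i, j) (g i j)%:R.

(* D^(-1/2).  The entry of a vertex of degree 0 is 0, since 0^-1 = 0. *)
Definition degree_invsqrt_mx (R : rcfType) (n : nat) (g : rel 'I_n) : 'M[R]_n :=
  diag_mx (\row_i (Num.sqrt (degree g i)%:R)^-1).

Definition normalized_laplacian (R : rcfType) (n : nat) (g : rel 'I_n)
    : 'M[R]_n :=
  1%:M - degree_invsqrt_mx R g *m adjacency_mx R g *m degree_invsqrt_mx R g.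

(* For a symmetric M all n eigenvalues are in R, so the largest eigenvalue is the
   last term of the ordered spectrum lambda_0 <= ... <= lambda_(n-1). *)
Definition is_largest_eigenvalue (R : rcfType) (n : nat) (M : 'M[R]_n)
    (lambda : R) : Prop :=
  eigenvalue M lambda /\ forall mu : R, eigenvalue M mu -> mu <= lambda.

(* Main.v *)
Require Import Defs.
From mathcomp Require Import all_boot all_order all_algebra.

(** Let B be the vertex-hyperedge incidence matrix.  The (u, v) entry of
    B B^T counts the hyperedges containing both u and v: off the diagonal
    linearity makes this number 0 or 1, so it is the adjacency matrix of the
    underlying graph; on the diagonal it is the number r(v) of hyperedges
    through v ([incidence_mx_gram]).  Double counting the pairs (h, w) with
    v, w in h gives deg(v) = (m - 1) r(v) ([degree_codegree]).  With A = B B^T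
    - diag(r), conjugating by D^(-1/2) therefore turns diag(r) into the scalar
    matrix 1 / (m - 1), and

      L = I - D^(-1/2) A D^(-1/2) = m / (m - 1) I - N N^T,

    where N = D^(-1/2) B ([normalized_laplacian_gram]).  Since N N^T is
    positive semidefinite, no eigenvalue of L exceeds m / (m - 1); since N has
    n rows and only e < n columns, N N^T has a nonzero kernel, on which L acts
    as m / (m - 1) ([largest_eigenvalue_scalar_sub_gram]). *)

Set Implicit Arguments.
Unset Strict Implicit.
Unset Printing Implicit Defensive.

Import Order.TTheory GRing.Theory Num.Theory.
Local Open Scope ring_scope.

Lemma row_dot_ge0 (R : realDomainType) (n : nat) (v : 'rV[R]_n) :
  0 <= (v *m v^T) 0 0.
Proof.
by rewrite mxE; apply: sumr_ge0 => i _; rewrite mxE -expr2 sqr_ge0.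
Qed.

Lemma row_dot_gt0 (R : realDomainType) (n : nat) (v : 'rV[R]_n) :
  v != 0 -> 0 < (v *m v^T) 0 0.
Proof.
move=> v_neq0; rewrite lt_def row_dot_ge0 andbT.
apply: contra v_neq0; rewrite mxE psumr_eq0; last first.
  by move=> i _; rewrite mxE -expr2 sqr_ge0.
move=> /allP v0; apply/eqP/rowP => i; rewrite mxE.
have := v0 i (mem_index_enum i).
by rewrite mxE mulf_eq0 orbb => /eqP.
Qed.

(** Upper bound: if v (a I - N N^T) = mu v, pairing with v gives
    (a - mu) |v|^2 = |v N|^2 >= 0.  The bound is attained because a matrix with
    fewer columns than rows kills some nonzero row vector. *)
Lemma largest_eigenvalue_scalar_sub_gram (R : rcfType) (n k : nat)
    (N : 'M[R]_(n, k)) (a : R) :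
  (k < n)%N -> is_largest_eigenvalue (a%:M - N *m N^T) a.
Proof.
move=> lt_kn; split.
  have : kermx N != 0.
    rewrite kermx_eq0 /row_free neq_ltn.
    by rewrite (leq_ltn_trans (rank_leq_col N) lt_kn).
  case/rowV0Pn=> v /sub_kermxP vN0 v_neq0.
  apply/eigenvalueP; exists v => //.
  by rewrite mulmxBr mul_mx_scalar mulmxA vN0 mul0mx subr0.
move=> mu /eigenvalueP[v]; rewrite mulmxBr mul_mx_scalar mulmxA => vL v_neq0.
have gramE : v *m N *m (v *m N)^T = (a - mu) *: (v *m v^T).
  rewrite trmx_mul mulmxA [in RHS]scalemxAl.
  by rewrite scalerBl -vL opprB addrCA subrr addr0.
have := row_dot_ge0 (v *m N).
by rewrite gramE mxE pmulr_lge0 ?row_dot_gt0 // subr_ge0.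
Qed.

(** The diagonal values [codegree H v v] are the vertex degrees of the
    hypergraph itself, as opposed to those of its underlying graph. *)
Definition codegree (V : finType) (H : {set {set V}}) (u v : V) : nat :=
  #|[set h in H | (u \in h) && (v \in h)]|.

(** Two hyperedges sharing two distinct vertices would contradict linearity, so
    the codegree of distinct vertices is at most 1. *)
Lemma codegree_underlying_graph (V : finType) (H : {set {set V}}) (u v : V) :
  linear_hypergraph H -> u != v -> codegree H u v = underlying_graph H u v.
Proof.
move=> lin_H neq_uv; rewrite /underlying_graph /= neq_uv /=.
case: existsP => [[h /andP[hH huv]] | no_h]; last first.
  apply: eq_card0 => h; rewrite inE; apply: contra_notF no_h => hh.
  by exists h.
apply/eqP/cards1P; exists h; apply/setP => h'; rewrite !inE.
apply/idP/eqP => [/and3P[h'H uh' vh'] | ->]; last by rewrite hH.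
apply: contraTeq neq_uv => neq_h; case/andP: huv => uh vh.
have /card_le1_eqP/(_ u v) -> := lin_H _ _ h'H hH neq_h.
- by rewrite eqxx.
- by rewrite inE uh'.
- by rewrite inE vh'.
Qed.

Lemma codegreeE (V : finType) (H : {set {set V}}) (u v : V) :
  codegree H u v = (\sum_(h in H) (u \in h) * (v \in h))%N.
Proof.
rewrite /codegree -sum1_card big_mkcond [RHS]big_mkcond /=.
by apply: eq_bigr => h _; rewrite inE; case: (h \in H); do 2!case: (_ \in h).
Qed.

(** Each of the hyperedges through v contains m vertices. *)
Lemma sum_codegree (V : finType) (m : nat) (H : {set {set V}}) (v : V) :
  uniform m H -> (\sum_w codegree H v w = m * codegree H v v)%N.
Proof.
move=> unif_H; under eq_bigr do rewrite codegreeE.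
rewrite exchange_big codegreeE big_distrr /=; apply: eq_bigr => h hH.
(* A boolean read as a number is an if-then-else between 1 and 0, so the inner
   sum over all w is a sum of 1 over h up to conversion. *)
by rewrite -big_distrr /= -big_mkcond sum1_card (unif_H h hH) mulnC mulnb andbb.
Qed.

(** Linearity is what prevents a neighbour of v from being counted in two
    hyperedges: each of them contributes m - 1 new neighbours. *)
Lemma degree_codegree (V : finType) (m : nat) (H : {set {set V}}) (v : V) :
    uniform m H -> linear_hypergraph H ->
  degree (underlying_graph H) v = (m.-1 * codegree H v v)%N.
Proof.
move=> unif_H lin_H; rewrite -subn1 mulnBl mul1n -(sum_codegree v unif_H).
rewrite (bigD1 v) //= addKn /degree -sum1_card big_mkcond [RHS]big_mkcond /=.
apply: eq_bigr => w _; rewrite inE; case: (eqVneq w v) => [-> | neq_wv] /=.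
  by rewrite /underlying_graph /= eqxx.
by rewrite codegree_underlying_graph 1?eq_sym.
Qed.

Lemma codegree_gt0 (V : finType) (H : {set {set V}}) (v : V) :
  no_isolated_vertex H -> (0 < codegree H v v)%N.
Proof.
by case/(_ v)=> h hH vh; apply/card_gt0P; exists h; rewrite inE hH vh.
Qed.

Definition incidence_mx (R : rcfType) (n : nat) (H : {set {set 'I_n}}) :
    'M[R]_(n, #|H|) :=
  \matrix_(i, k) (i \in (enum_val k : {set 'I_n}))%:R.

Definition codegree_diag_mx (R : rcfType) (n : nat) (H : {set {set 'I_n}}) :
    'M[R]_n :=
  diag_mx (\row_i (codegree H i i)%:R).

Lemma incidence_mx_gram (R : rcfType) (n : nat) (H : {set {set 'I_n}}) :
    linear_hypergraph H ->
  incidence_mx R H *m (incidence_mx R H)^T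
    = adjacency_mx R (underlying_graph H) + codegree_diag_mx R H.
Proof.
move=> lin_H; apply/matrixP => i j.
have -> : (incidence_mx R H *m (incidence_mx R H)^T) i j
    = (codegree H i j)%:R.
  rewrite mxE codegreeE [in RHS]big_enum_val natr_sum.
  by apply: eq_bigr => k _; rewrite !mxE natrM.
rewrite !mxE; case: (eqVneq i j) => [<- | neq_ij].
  by rewrite /underlying_graph /= eqxx /= add0r mulr1n.
by rewrite codegree_underlying_graph // mulr0n addr0.
Qed.

(** Because deg = (m - 1) r, normalizing diag(r) by the degrees leaves a scalar
    matrix; the covering hypothesis keeps the degrees nonzero. *)
Lemma normalized_codegree_diag_mx (R : rcfType) (m n : nat)
    (H : {set {set 'I_n}}) :
    (2 <= m)%N -> uniform m H -> linear_hypergraph H -> no_isolated_vertex H ->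
  let S := degree_invsqrt_mx R (underlying_graph H) in
  S *m codegree_diag_mx R H *m S = (m%:R - 1)^-1%:M.
Proof.
move=> m_ge2 unif_H lin_H cover_H /=.
rewrite /degree_invsqrt_mx /codegree_diag_mx !mulmx_diag.
apply/matrixP => i j; rewrite !mxE; congr (_ *+ _).
have r_neq0 : (codegree H i i)%:R != 0 :> R.
  by rewrite pnatr_eq0 -lt0n codegree_gt0.
set d := degree _ i.
have sqr_sqrt : Num.sqrt d%:R * Num.sqrt d%:R = d%:R :> R.
  by rewrite -expr2 sqr_sqrtr ?ler0n.
rewrite mulrAC -invfM sqr_sqrt /d (degree_codegree _ unif_H lin_H) natrM.
by rewrite invfM -mulrA mulVf // mulr1 -subn1 natrB // ltnW.
Qed.

Lemma normalized_laplacian_gram (R : rcfType) (m n : nat)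
    (H : {set {set 'I_n}}) :
    (2 <= m)%N -> uniform m H -> linear_hypergraph H -> no_isolated_vertex H ->
  let N := degree_invsqrt_mx R (underlying_graph H) *m incidence_mx R H in
  normalized_laplacian R (underlying_graph H)
    = (m%:R / (m%:R - 1))%:M - N *m N^T.
Proof.
move=> m_ge2 unif_H lin_H cover_H /=.
have SrS := normalized_codegree_diag_mx R m_ge2 unif_H lin_H cover_H.
rewrite /= in SrS; rewrite /normalized_laplacian.
set S := degree_invsqrt_mx R _ in SrS *.
have St : S^T = S by rewrite tr_diag_mx.
rewrite trmx_mul St mulmxA -(mulmxA S (incidence_mx R H)) incidence_mx_gram //.
rewrite mulmxDr mulmxDl SrS opprD addrCA addrC; congr (_ + _).
have m1_neq0 : m%:R - 1 != 0 :> R.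
  by rewrite subr_eq0 pnatr_eq1 neq_ltn m_ge2 orbT.
rewrite -raddfB /=; congr _%:M.
by rewrite -[X in _ - X]mul1r -mulrBl divff.
Qed.

Lemma normalized_laplacian_eq (R : rcfType) (n : nat) (g g' : rel 'I_n) :
  g =2 g' -> normalized_laplacian R g = normalized_laplacian R g'.
Proof.
move=> eq_g; have adjE : adjacency_mx R g = adjacency_mx R g'.
  by apply/matrixP => i j; rewrite !mxE eq_g.
have degE i : degree g i = degree g' i.
  by apply: eq_card => j; rewrite !inE eq_g.
rewrite /normalized_laplacian /degree_invsqrt_mx adjE.
by under eq_mx do rewrite degE.
Qed.

Theorem theorem16 (R : rcfType) (m n e : nat) (hm : (2 <= m)%N)
    (G : rel 'I_n) (hG : simple_graph G)
    (H : {set {set 'I_n}})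
    (hunif : uniform m H) (hlin : linear_hypergraph H)
    (hcard : #|H| = e) (hcover : no_isolated_vertex H)
    (hGH : G =2 underlying_graph H)
    (hne : (e < n)%N) :
  is_largest_eigenvalue (normalized_laplacian R G) (m%:R / (m%:R - 1)).
Proof.
rewrite (normalized_laplacian_eq R hGH).
rewrite (normalized_laplacian_gram R hm hunif hlin hcover).
by apply: largest_eigenvalue_scalar_sub_gram; rewrite hcard.
Qed.
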